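(* For each positive integer $n$, place $n$ hyper-bishops at random on the $3$-dimensional chessboard with side length $n$, and let $\mu_{n,3}$ be the expected proportion of safe spaces. Then in the limit $n\to\infty$ the expected proportion of safe spaces lies between $1/e^3$ and $1/e^{3/2}$, that is, $$\frac{1}{e^{3}}\le \liminf_{n\to\infty}\mu_{n,3}\le\limsup_{n\to\infty}\mu_{n,3}\le \frac{1}{e^{3/2}}.$$
   Context: The $3$-dimensional board of side length $n$ is the set of spaces $\{1,\dots,n\}^3$. ''Placing $n$ pieces at random'' means that the set of occupied spaces (the board configuration) is chosen uniformly among all $\binom{n^3}{n}$ subsets of $n$ distinct spaces. A hyper-bishop at $(a_1,a_2,a_3)$ attacks a space $(x_1,x_2,x_3)$ if $(x_1-a_1)\pm(x_2-a_2)\pm(x_3-a_3)=0$ for some choice of the two signs. A space is safe under a board configuration if it is neither occupied nor attacked by any of the placed pieces. The expected proportion of safe spaces $\mu_{n,3}$ is the expected number of safe spaces divided by $n^3$. *)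

(* Defs.v *)
From mathcomp Require Import all_boot all_order all_algebra.
From mathcomp Require Import all_classical all_reals all_analysis.

Set Implicit Arguments.
Unset Strict Implicit.
Unset Printing Implicit Defensive.

Import Order.TTheory GRing.Theory Num.Theory.
Local Open Scope ring_scope.

(* Coordinates range over {0, ..., n-1} instead of {1, ..., n}; only coordinate
   differences matter below. *)
Notation board n := ('I_n * 'I_n * 'I_n)%type.

Definition coord1 (n : nat) (x : board n) : int := (x.1.1 : nat)%:Z.
Definition coord2 (n : nat) (x : board n) : int := (x.1.2 : nat)%:Z.
Definition coord3 (n : nat) (x : board n) : int := (x.2 : nat)%:Z.

(* The booleans s and t choose the two signs: (-1) ^+ s is 1 or -1. *)
Definition attacks (n : nat) (a x : board n) : bool :=
  [exists s : bool, exists t : bool,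
    (coord1 x - coord1 a) + (-1) ^+ s * (coord2 x - coord2 a)
      + (-1) ^+ t * (coord3 x - coord3 a) == 0].

Definition safe (n : nat) (B : {set board n}) : {set board n} :=
  [set x | (x \notin B) && [forall a in B, ~~ attacks a x]].

Definition configurations (n : nat) : {set {set board n}} :=
  [set B : {set board n} | #|B| == n].

(* Expectation of f under the uniform distribution on A. *)
Definition uniform_expectation (R : realType) (T : finType) (A : {set T})
    (f : T -> R) : R :=
  (\sum_(B in A) f B) / #|A|%:R.

(* mu R n is the expected proportion of safe spaces on the board of side n. *)
Definition mu (R : realType) (n : nat) : R :=
  uniform_expectation (configurations n) (fun B => #|safe B|%:R)
    / (n ^ 3)%N%:R.

(* Main.v *)
Require Import Defs.
From mathcomp Require Import all_boot all_order all_algebra.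
From mathcomp Require Import all_classical all_reals all_analysis.
From mathcomp Require Import zify ring lra.

(* A space x is safe exactly when no piece lies in the set D of the spaces on
   the four planes through x (x included), which has probability
   'C(n^3 - #|D|, n) / 'C(n^3, n), so it suffices that
   3/2 n^2 - O(n) <= #|D| <= 3 n^2 + O(1) for every x.  Up to O(n) spaces on the
   pairwise intersections, #|D| is a sum of diagonal lengths of an n x n square:
   the layer at height w relative to x meets the planes in two diagonals and two
   antidiagonals.  With g k = max(0, n - |k|), these have lengths
   g (p + w), g (p - w), g (q + w), g (q - w), where p and q, with |p| + |q| < n,
   locate x in its layer.  This layer total is even and decreasing in |w|, so the
   sum over the heights is least when x is on a face, where it is
   2 n^2 - (p^2 + q^2) / 2 up to O(n).  It is at most 4 max(|w|, n - |w|), a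
   function invariant under w -> n - w, so that the sum of this bound over all
   heights does not depend on the height of x. *)

Set Implicit Arguments.
Unset Strict Implicit.
Unset Printing Implicit Defensive.

Import Order.TTheory GRing.Theory Num.Theory.
Import numFieldNormedType.Exports.
Local Open Scope ring_scope.

(** * Diagonal lengths and layer totals *)

Definition tent (n : nat) (k : int) : int := Num.max 0 (n%:Z - `|k|).

Definition tent_pair (n : nat) (p w : int) : int := tent n (p + w) + tent n (p - w).

Lemma tentN n k : tent n (- k) = tent n k.
Proof. by rewrite /tent normrN. Qed.

Lemma tent_pairN n p w : tent_pair n (- p) w = tent_pair n p w.
Proof. rewrite /tent_pair -(tentN n (- p + w)) -(tentN n (- p - w)) !opprD !opprK addrC //. Qed.

Lemma tent_pair_normr n p w : tent_pair n `|p| w = tent_pair n p w.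
Proof. by have [_|_] := ger0P p; rewrite ?tent_pairN. Qed.

Lemma tent_pair_even n p w : tent_pair n p (- w) = tent_pair n p w.
Proof. by rewrite /tent_pair opprK addrC. Qed.

(** Until [|p| + w] reaches [n], one tent falls with slope -1 and offsets any rise of the other;
    growth is confined to [w > n - |p|], with slope at most 1. *)
Lemma tent_pair_growth n (p w w' : int) : 0 <= w <= w' -> w' <= n%:Z ->
  tent_pair n p w' <= tent_pair n p w + Num.max 0 (w' - Num.max w (n%:Z - `|p|)).
Proof.
rewrite -(tent_pair_normr n p) -(tent_pair_normr n p w).
move: `|p| (normr_ge0 p) => {}p; rewrite /tent_pair /tent => *; lia.
Qed.

(** Up to [w = |q|] the two slopes cancel, because [2 * |q| <= n] keeps [|q| + w] within [n]; beyond
    it no tent rises and one falls with slope -1. *)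
Lemma tent_pair_decay n (q w w' : int) : 2 * `|q| <= n%:Z -> 0 <= w <= w' -> w' <= n%:Z ->
  tent_pair n q w' <= tent_pair n q w - Num.max 0 (w' - Num.max w `|q|).
Proof.
rewrite -(tent_pair_normr n q) -(tent_pair_normr n q w).
move: `|q| (normr_ge0 q) => {}q; rewrite /tent_pair /tent => *; lia.
Qed.

Lemma tent_pair_le n p w : 0 <= w <= n%:Z -> `|p| <= n%:Z ->
  tent_pair n p w <= 2 * Num.max w (n%:Z - w).
Proof.
rewrite -(tent_pair_normr n p).
move: `|p| (normr_ge0 p) => {}p; rewrite /tent_pair /tent => *; lia.
Qed.

Definition layer (n : nat) (p q w : int) : int := tent_pair n p w + tent_pair n q w.

(* Where one of the two pairs grows, the other one decays at least as fast. *)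
Lemma layer_anti n p q w w' : `|p| + `|q| <= n%:Z -> 0 <= w <= w' -> w' <= n%:Z ->
  layer n p q w' <= layer n p q w.
Proof.
move=> pq ww' w'n; rewrite /layer.
(* The pair of smaller offset has [2 * |q| <= n] and decays from [|q| <= n - |p|] on, before the
   other can grow. *)
wlog qp : p q pq / `|q| <= `|p|.
  move=> H; have [/H->//|/ltW/H] := lerP `|q| `|p|.
  by rewrite addrC pq addrC [X in _ <= X]addrC; apply.
have := tent_pair_growth p ww' w'n; have := @tent_pair_decay n q w w'.
lia.
Qed.

Lemma layer_le n p q w : `|p| + `|q| <= n%:Z -> 0 <= w <= n%:Z ->
  layer n p q w <= 4 * Num.max w (n%:Z - w).
Proof.
move=> pq wn; rewrite /layer.
have := @tent_pair_le n p w wn; have := @tent_pair_le n q w wn; lia.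
Qed.

(** * Sums over the heights *)

Lemma sum_ord_interval (n : nat) (lo hi : int) :
  \sum_(i < n) Posz (lo <= i%:Z < hi)%R =
  Num.max 0 (Num.min hi n%:Z - Num.max lo 0).
Proof.
elim: n => [|n IHn]; first by rewrite big_ord0; lia.
by rewrite big_ord_recr /= IHn; lia.
Qed.

Lemma sum_ord_eq (n : nat) (c : int) :
  \sum_(i < n) Posz (i%:Z == c) = Posz (0 <= c < n%:Z)%R.
Proof.
rewrite (eq_bigr (fun i : 'I_n => Posz (c <= i%:Z < c + 1)%R)) => [|i _]; last by lia.
by rewrite sum_ord_interval; lia.
Qed.

(** Removing the first and last terms leaves the sum for [n - 2] with 1 added to each term, hence
    the induction by steps of two. The final 1 is attained for odd [n]. *)
Lemma sum_max_le n :
  4 * \sum_(i < n) Num.max i%:Z (n%:Z - i%:Z) <= 3 * (n%:Z * n%:Z) + 1.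
Proof.
elim/ltn_ind: n => -[|[|n]] IH; rewrite ?big_ord0 ?big_ord1 //.
rewrite big_ord_recl big_ord_recr /=.
rewrite (eq_bigr (fun i : 'I_n => 1 + Num.max i%:Z (n%:Z - i%:Z))) => [|i _]; last first.
  by rewrite /bump /=; lia.
rewrite big_split /= sumr_const card_ord.
have := IH n (leqnSn _); set s := \sum_(i < n) _ => h.
rewrite /bump /= mulrDr mulrDr mulrDr. nia.
Qed.

(* Induction on p: the difference of the sums at p + 1 and p telescopes in w. *)
Lemma sum_tent_pair (n p : nat) : (p <= n)%N ->
  2 * \sum_(w < n) tent_pair n p%:Z w%:Z =
    2 * (n%:Z * n%:Z) + 2 * n%:Z - p%:Z * p%:Z - 3 * p%:Z.
Proof.
elim: p => [|p IH] pn.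
  rewrite subr0 mulr0 subr0.
  have E (m : nat) : (m <= n)%N ->
      2 * \sum_(w < m) tent_pair n 0 w%:Z = m%:Z * (4 * n%:Z + 2 - 2 * m%:Z).
    elim: m => [|m IHm] mn; first by rewrite big_ord0 mul0r mulr0.
    rewrite big_ord_recr /= mulrDr IHm; last by apply: ltnW.
    rewrite /tent_pair /tent; nia.
  rewrite E //; nia.
have E (m : nat) : \sum_(w < m) tent_pair n p.+1%:Z w%:Z =
    \sum_(w < m) tent_pair n p%:Z w%:Z
    + tent n (p%:Z + m%:Z) - tent n p%:Z + tent n p.+1%:Z - tent n (p.+1%:Z - m%:Z).
  elim: m => [|m IHm]; first by rewrite !big_ord0 addr0 subr0; lia.
  rewrite !big_ord_recr /= IHm /tent_pair.
  rewrite (_ : p.+1%:Z - m.+1%:Z = p%:Z - m%:Z); last by lia.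
  rewrite (_ : p%:Z + m.+1%:Z = p.+1%:Z + m%:Z); last by lia.
  move: (tent n _) (tent n _) (tent n _) (tent n _) (tent n _) (tent n _) (\sum_(i < m) _).
  lia.
have {}IH := IH (ltnW pn); rewrite E; move: IH; set s := \sum_(w < n) _ => IH.
rewrite /tent; nia.
Qed.

Lemma sum_ord_cut (n c : nat) (F : nat -> int) : (c <= n)%N ->
  \sum_(k < n) F k = \sum_(k < c) F k + \sum_(k < n - c) F (c + k)%N.
Proof.
by move=> cn; rewrite -[in LHS](subnKC cn) big_split_ord.
Qed.

Lemma layer_even n p q w : layer n p q (- w) = layer n p q w.
Proof. by rewrite /layer !tent_pair_even. Qed.

(** Indices [k >= c] match the first [n - c] terms of [sum_max_le]; an index [k < c], at distance
    [c - k], matches the reflected term [n - c + k]. *)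
Lemma sum_layer_le n p q c : (c < n)%N -> `|p| + `|q| <= n%:Z ->
  \sum_(k < n) layer n p q (c%:Z - k%:Z) <= 3 * (n%:Z * n%:Z) + 1.
Proof.
move=> cn pq; apply: le_trans (sum_max_le n); rewrite mulr_sumr.
rewrite (@sum_ord_cut n c (fun k => layer n p q (c%:Z - k%:Z)) (ltnW cn)).
rewrite (@sum_ord_cut n (n - c) (fun k => 4 * Num.max k%:Z (n%:Z - k%:Z))) ?leq_subr //.
rewrite subKn ?(ltnW cn) // addrC; apply: lerD; apply: ler_sum => k _; have kn := ltn_ord k.
  rewrite -layer_even opprB (_ : (c + k)%N%:Z - c%:Z = k%:Z); last by lia.
  by apply: layer_le => //; lia.
apply: le_trans (layer_le pq _) _; first by lia.
lia.
Qed.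

(* [layer_anti] moves the part of the window beyond the origin to the far end. *)
Lemma sum_layer_ge n p q c : (c < n)%N -> `|p| + `|q| <= n%:Z ->
  \sum_(w < n) layer n p q w%:Z <= \sum_(k < n) layer n p q (c%:Z - k%:Z).
Proof.
move=> cn pq; rewrite [leRHS](@sum_ord_cut n c (fun k => layer n p q (c%:Z - k%:Z)) (ltnW cn)).
rewrite (@sum_ord_cut n (n - c) (fun k => layer n p q k%:Z)) ?leq_subr //.
rewrite subKn ?(ltnW cn) // addrC; apply: lerD; last first.
  apply: ler_sum => k _; rewrite -[leRHS]layer_even.
  by rewrite (_ : - (c%:Z - (c + k)%N%:Z) = k%:Z) //; lia.
(* Reversal pairs height [k + 1] with [n - c + k], which is no smaller since [c < n]. *)
rewrite [leRHS](reindex_inj rev_ord_inj) /=; apply: ler_sum => k _.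
have kc := ltn_ord k; apply: layer_anti => //; lia.
Qed.

(** In the closed form [p^2 + q^2 <= (|p| + |q|)^2 < n^2], which costs at most a quarter of
    [4 n^2]. *)
Lemma sum_layer n p q : `|p| + `|q| < n%:Z ->
  3 * (n%:Z * n%:Z) <= 2 * \sum_(w < n) layer n p q w%:Z.
Proof.
move=> pq; rewrite /layer big_split mulrDr.
have E r : \sum_(w < n) tent_pair n r w%:Z = \sum_(w < n) tent_pair n (Posz `|r|%N) w%:Z.
  by apply: eq_bigr => w _; rewrite -tent_pair_normr abszE.
rewrite (E p) (E q) !sum_tent_pair; [|lia..].
rewrite !abszE; nia.
Qed.

(** * The four planes and their intersections *)

Lemma antidiagonal_count n (e : int) :
  \sum_(i < n) \sum_(j < n) Posz (i%:Z + j%:Z == e) = tent n (e - (n%:Z - 1)).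
Proof.
rewrite (eq_bigr (fun i : 'I_n => Posz (e - n%:Z + 1 <= i%:Z < e + 1)%R)) => [|i _].
  by rewrite sum_ord_interval /tent; lia.
rewrite (eq_bigr (fun j : 'I_n => Posz (j%:Z == e - i%:Z))) => [|j _]; last by lia.
by rewrite sum_ord_eq; lia.
Qed.

Lemma diagonal_count n (e : int) :
  \sum_(i < n) \sum_(j < n) Posz (i%:Z - j%:Z == e) = tent n e.
Proof.
rewrite (eq_bigr (fun i : 'I_n => Posz (e <= i%:Z < e + n%:Z)%R)) => [|i _].
  by rewrite sum_ord_interval /tent; lia.
rewrite (eq_bigr (fun j : 'I_n => Posz (j%:Z == i%:Z - e))) => [|j _]; last by lia.
by rewrite sum_ord_eq; lia.
Qed.

(** Counting with multiplicity makes the sum over a layer an exact sum of diagonal lengths. *)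
Definition planes (u v w : int) : int :=
  Posz (u + v + w == 0) + Posz (u + v - w == 0) + Posz (u - v + w == 0)
  + Posz (u - v - w == 0).

Definition on_plane (u v w : int) : bool :=
  [|| u + v + w == 0, u + v - w == 0, u - v + w == 0 | u - v - w == 0].

Lemma sum_planes n (a b c : nat) :
  \sum_(k < n) \sum_(i < n) \sum_(j < n) planes (a%:Z - i%:Z) (b%:Z - j%:Z) (c%:Z - k%:Z) =
  \sum_(k < n) layer n (a%:Z + b%:Z - (n%:Z - 1)) (a%:Z - b%:Z) (c%:Z - k%:Z).
Proof.
apply: eq_bigr => k _; move: (c%:Z - k%:Z) => w; rewrite /layer /tent_pair.
rewrite -[tent n (a%:Z - b%:Z + w)]diagonal_count -[tent n (a%:Z - b%:Z - w)]diagonal_count.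
rewrite (_ : a%:Z + b%:Z - (n%:Z - 1) + w = a%:Z + b%:Z + w - (n%:Z - 1)); last by lia.
rewrite (_ : a%:Z + b%:Z - (n%:Z - 1) - w = a%:Z + b%:Z - w - (n%:Z - 1)); last by lia.
rewrite -!antidiagonal_count addrA -!big_split /=; apply: eq_bigr => i _.
rewrite -!big_split /=; apply: eq_bigr => j _; rewrite /planes; lia.
Qed.

(* The pairwise intersections of the four planes are these six lines. *)
Definition meets (u v w : int) : int :=
  Posz ((u == 0) && (w == v)) + Posz ((u == 0) && (w == - v))
  + (Posz ((v == 0) && (w == u)) + Posz ((v == 0) && (w == - u)))
  + (Posz ((v == u) && (w == 0)) + Posz ((v == - u) && (w == 0))).

Lemma on_plane_le u v w : Posz (on_plane u v w) <= planes u v w.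
Proof. rewrite /on_plane /planes; lia. Qed.

(** Overcounting means that two of the plane equations hold, and each pair of them cuts out one of
    the six lines. *)
Lemma meets_gt0 u v w : Posz (on_plane u v w) < planes u v w -> 1 <= meets u v w.
Proof.
have some b1 b2 b3 b4 b5 b6 : [|| b1, b2, b3, b4, b5 | b6] ->
    1 <= Posz b1 + Posz b2 + (Posz b3 + Posz b4) + (Posz b5 + Posz b6).
  by case: b1 b2 b3 b4 b5 b6 => [] [] [] [] [] [].
move=> h; apply: some; move: h; rewrite /on_plane /planes.
case: (eqVneq (u + v + w) 0) => E1; case: (eqVneq (u + v - w) 0) => E2;
case: (eqVneq (u - v + w) 0) => E3; case: (eqVneq (u - v - w) 0) => E4 //= _.
all: first
  [ (have -> : (v == - u) && (w == 0) by lia)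
  | (have -> : (v == u) && (w == 0) by lia)
  | (have -> : (v == 0) && (w == u) by lia)
  | (have -> : (v == 0) && (w == - u) by lia)
  | (have -> : (u == 0) && (w == v) by lia)
  | (have -> : (u == 0) && (w == - v) by lia) ].
all: by rewrite ?orbT.
Qed.

(** Four planes overcount a space by at most 3, and only on the six lines. *)
Lemma on_plane_ge u v w : planes u v w - 3 * meets u v w <= Posz (on_plane u v w).
Proof.
have m0 : 0 <= meets u v w by rewrite /meets !addr_ge0.
have p4 : planes u v w <= 3 + Posz (on_plane u v w).
  by rewrite /planes /on_plane; move: (_ == 0) (_ == 0) (_ == 0) (_ == 0) => [] [] [] [].
by move: (@meets_gt0 u v w) m0 p4; move: (meets u v w) (planes u v w) (on_plane u v w) => m s o; lia.
Qed.

Lemma sum_ord_eq_le n (P : bool) (c : int) (f : 'I_n -> bool) :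
  (forall k, f k = (k%:Z == c)) -> \sum_(k < n) Posz (P && f k) <= Posz P.
Proof.
move=> fE; case: P => /=; last by rewrite big1.
rewrite (eq_bigr (fun k : 'I_n => Posz (k%:Z == c))) => [|k _]; last by rewrite fE.
by rewrite sum_ord_eq; lia.
Qed.

Lemma sum_line_le n (P : 'I_n -> 'I_n -> bool) (f : 'I_n -> 'I_n -> 'I_n -> bool)
    (c : 'I_n -> 'I_n -> int) :
  (forall i j k, f i j k = (k%:Z == c i j)) ->
  \sum_(i < n) \sum_(j < n) \sum_(k < n) Posz (P i j && f i j k) <=
  \sum_(i < n) \sum_(j < n) Posz (P i j).
Proof.
by move=> fE; do 2![apply: ler_sum => ? _]; apply: sum_ord_eq_le => k; apply: fE.
Qed.

Lemma sum_point_le n (P : 'I_n -> 'I_n -> bool) (c : 'I_n -> int) :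
  (forall i j, P i j = (j%:Z == c i)) ->
  \sum_(i < n) \sum_(j < n) Posz (P i j) <= n%:Z.
Proof.
move=> PE; rewrite -[leRHS](_ : \sum_(i < n) 1 = n%:Z); last first.
  by rewrite sumr_const card_ord; lia.
by apply: ler_sum => i _; apply: (@sum_ord_eq_le n true (c i) (P i)) => j.
Qed.

Lemma sum_meets n (a b c : nat) :
  \sum_(i < n) \sum_(j < n) \sum_(k < n) meets (a%:Z - i%:Z) (b%:Z - j%:Z) (c%:Z - k%:Z)
  <= 6 * n%:Z.
Proof.
have add3 (F G : 'I_n -> 'I_n -> 'I_n -> int) :
    \sum_(i < n) \sum_(j < n) \sum_(k < n) (F i j k + G i j k) =
    \sum_(i < n) \sum_(j < n) \sum_(k < n) F i j k
    + \sum_(i < n) \sum_(j < n) \sum_(k < n) G i j k.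
  by rewrite -big_split; apply: eq_bigr => i _; rewrite -big_split; apply: eq_bigr => j _;
     rewrite big_split.
rewrite /meets !add3 (_ : 6 * n%:Z = n%:Z + n%:Z + (n%:Z + n%:Z) + (n%:Z + n%:Z)); last by lia.
(* On each line [k] is a function of [i] and [j], and one of [i], [j] is determined by the other or
   constant, so a line has at most [n] spaces. *)
apply: lerD; [apply: lerD|]; apply: lerD.
- apply: le_trans (sum_line_le _ (c := fun i j => c%:Z - (b%:Z - j%:Z)) _) _; first by lia.
  by rewrite exchange_big; apply: (@sum_point_le n _ (fun=> a%:Z)); lia.
- apply: le_trans (sum_line_le _ (c := fun i j => c%:Z + (b%:Z - j%:Z)) _) _; first by lia.
  by rewrite exchange_big; apply: (@sum_point_le n _ (fun=> a%:Z)); lia.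
- apply: le_trans (sum_line_le _ (c := fun i j => c%:Z - (a%:Z - i%:Z)) _) _; first by lia.
  by apply: (@sum_point_le n _ (fun=> b%:Z)); lia.
- apply: le_trans (sum_line_le _ (c := fun i j => c%:Z + (a%:Z - i%:Z)) _) _; first by lia.
  by apply: (@sum_point_le n _ (fun=> b%:Z)); lia.
- apply: le_trans (sum_line_le _ (c := fun i j => c%:Z) _) _; first by lia.
  by apply: (@sum_point_le n _ (fun i => b%:Z - (a%:Z - i%:Z))); lia.
- apply: le_trans (sum_line_le _ (c := fun i j => c%:Z) _) _; first by lia.
  by apply: (@sum_point_le n _ (fun i => b%:Z + (a%:Z - i%:Z))); lia.
Qed.

(** * The number of attackers *)

Lemma attacksE n (y x : board n) :
  attacks y x = on_plane (coord1 x - coord1 y) (coord2 x - coord2 y) (coord3 x - coord3 y).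
Proof.
rewrite /on_plane; apply/existsP/idP => [[s /existsP[t]]|].
  by case: s; case: t; rewrite ?expr0 ?expr1 ?mul1r ?mulN1r => ->; rewrite ?orbT.
by case/or4P => h; [exists false|exists false|exists true|exists true]; apply/existsP;
   [exists false|exists true|exists false|exists true]; rewrite ?expr0 ?expr1 ?mul1r ?mulN1r.
Qed.

Definition attackers (n : nat) (x : board n) : {set board n} := [set y | attacks y x].

Lemma card_attackers n (x : board n) :
  Posz #|attackers x| = \sum_(i < n) \sum_(j < n) \sum_(k < n)
    Posz (on_plane (x.1.1%:Z - i%:Z) (x.1.2%:Z - j%:Z) (x.2%:Z - k%:Z)).
Proof.
rewrite pair_bigA pair_bigA /= -sum1_card big_mkcond /=.
rewrite (big_morph Posz PoszD (erefl 0%:Z)).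
by apply: eq_bigr => y _; rewrite inE attacksE; case: on_plane.
Qed.

(** The constant 36 is twice the overcount bound [3 * 6]. *)
Lemma card_attackers_bounds n (x : board n) :
  (3 * n ^ 2 <= 2 * #|attackers x| + 36 * n)%N /\ (#|attackers x| <= 3 * n ^ 2 + 1)%N.
Proof.
have := card_attackers x; case: x => [[a b] c] /=; set d := #|_| => dE.
have [[an bn] cn] := (ltn_ord a, ltn_ord b, ltn_ord c).
pose p : int := a%:Z + b%:Z - (n%:Z - 1); pose q : int := a%:Z - b%:Z.
(* [|p| + |q|] is the larger of [|p + q| = |2 a - (n - 1)|] and [|p - q| = |2 b - (n - 1)|]. *)
have pq : `|p| + `|q| < n%:Z by rewrite /p /q; lia.
have S : \sum_(i < n) \sum_(j < n) \sum_(k < n)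
    planes (a%:Z - i%:Z) (b%:Z - j%:Z) (c%:Z - k%:Z) =
    \sum_(k < n) layer n p q (c%:Z - k%:Z).
  rewrite -sum_planes; rewrite [RHS]exchange_big; apply: eq_bigr => i _.
  by rewrite exchange_big.
have lo := le_trans (sum_layer pq) (ler_wpM2l (isT : 0 <= 2 :> int) (sum_layer_ge cn (ltW pq))).
have up := sum_layer_le cn (ltW pq).
have M := sum_meets n a b c.
have dup : d%:Z <= \sum_(k < n) layer n p q (c%:Z - k%:Z).
  by rewrite dE -S; do 3![apply: ler_sum => ? _]; apply: on_plane_le.
have dlo : \sum_(k < n) layer n p q (c%:Z - k%:Z) - 3 * (6 * n%:Z) <= d%:Z.
  rewrite dE -S; apply: le_trans (lerB (lexx _) (ler_wpM2l (isT : 0 <= 3 :> int) M)) _.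
  rewrite mulr_sumr -sumrB; apply: ler_sum => i _.
  rewrite mulr_sumr -sumrB; apply: ler_sum => j _.
  rewrite mulr_sumr -sumrB; apply: ler_sum => k _; apply: on_plane_ge.
split; lia.
Qed.

(** * The mean as a binomial ratio *)

Lemma card_board n : #|{: board n}| = (n ^ 3)%N.
Proof. by rewrite !card_prod card_ord; lia. Qed.

Lemma mem_safe n (B : {set board n}) x : (x \in safe B) = (B \subset ~: attackers x).
Proof.
rewrite inE; apply/andP/fintype.subsetP => [[xB /forall_inP aB] y yB|aB].
  by rewrite !inE aB.
split; last by apply/forall_inP => y /aB; rewrite !inE.
(* A space attacks itself, so avoiding [attackers x] already leaves [x] unoccupied. *)
by apply/negP => /aB; rewrite !inE attacksE /on_plane !subrr.
Qed.

Lemma sum_card_safe n :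
  (\sum_(B in configurations n) #|safe B| =
   \sum_(x : board n) 'C(n ^ 3 - #|attackers x|, n))%N.
Proof.
under eq_bigr do rewrite -sum1_card big_mkcond /=.
rewrite exchange_big; apply: eq_bigr => x _ /=.
rewrite -big_mkcondr /= sum1_card -card_board.
have -> : (#|{: board n}| - #|attackers x| = #|~: attackers x|)%N.
  by rewrite -cardsT -cardsDS ?finset.subsetT // finset.setTD.
rewrite -cards_draws -[RHS]cardsE; apply: eq_card => B.
by rewrite [LHS]unfold_in /= mem_safe !inE andbC.
Qed.

Lemma muE (R : realType) n :
  mu R n = (\sum_(x : board n) 'C(n ^ 3 - #|attackers x|, n)%:R / 'C(n ^ 3, n)%:R)
           / (n ^ 3)%N%:R.
Proof.
rewrite /mu /uniform_expectation -natr_sum sum_card_safe natr_sum mulr_suml.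
have -> : #|configurations n| = 'C(n ^ 3, n); last by [].
rewrite -card_board -cardsT -cards_draws /configurations -cardsE.
by apply: eq_card => B; rewrite !inE finset.subsetT.
Qed.

(** * Exponential bounds on binomial ratios *)

Lemma expn_prod m n : (m ^ n = \prod_(i < n) m)%N.
Proof. by rewrite prod_nat_const card_ord. Qed.

(** The binomial ratio is the product of [(N - d - i) / (N - i)] over [i < n]. These factors do not
    increase with [i], so the value at [i = 0] bounds them above. *)
Lemma bin_upper N d n : (n <= N)%N -> ('C(N - d, n) * N ^ n <= (N - d) ^ n * 'C(N, n))%N.
Proof.
move=> nN; rewrite -(leq_pmul2r (fact_gt0 n)) -mulnA (mulnC _ n`!) mulnA bin_ffact.
rewrite -mulnA bin_ffact !ffact_prod.
rewrite !expn_prod -!big_split /=.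
apply: leq_prod => i _; have := ltn_ord i; nia.
Qed.

(** The same factors are bounded below by their value at [i = n]. *)
Lemma bin_lower N d n : (d + n <= N)%N ->
  ((N - d - n) ^ n * 'C(N, n) <= 'C(N - d, n) * (N - n) ^ n)%N.
Proof.
move=> nN; rewrite -(leq_pmul2r (fact_gt0 n)) -mulnA bin_ffact.
rewrite -mulnA (mulnC _ n`!) mulnA bin_ffact !ffact_prod.
rewrite !expn_prod -!big_split /=.
apply: leq_prod => i _; have := ltn_ord i; nia.
Qed.

Lemma bin_ratio_le (R : realType) N d n : (0 < N)%N -> (n <= N)%N -> (d <= N)%N ->
  'C(N - d, n)%:R / 'C(N, n)%:R <= expR (- (n%:R * (d%:R / N%:R))) :> R.
Proof.
move=> N0 nN dN; have C0 : 0 < 'C(N, n)%:R :> R by rewrite ltr0n bin_gt0.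
have N0' : 0 < N%:R :> R by rewrite ltr0n.
rewrite ler_pdivrMr //.
apply: (@le_trans _ _ (((N - d)%:R / N%:R) ^+ n * 'C(N, n)%:R)).
  rewrite expr_div_n mulrAC ler_pdivlMr ?exprn_gt0 //.
  by rewrite -!natrX -!natrM ler_nat bin_upper.
rewrite ler_pM2r // -mulrN expRM_natl lerXn2r ?nnegrE ?expR_ge0 ?divr_ge0 //.
apply: le_trans (expR_ge1Dx _).
by rewrite natrB // mulrBl divff ?gt_eqF.
Qed.

Lemma bin_ratio_ge (R : realType) N d n : (d + n < N)%N ->
  expR (- (n%:R * (d%:R / (N - n - d)%:R))) <= 'C(N - d, n)%:R / 'C(N, n)%:R :> R.
Proof.
move=> nN; have C0 : 0 < 'C(N, n)%:R :> R by rewrite ltr0n bin_gt0; lia.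
have N0 : 0 < (N - n)%:R :> R by rewrite ltr0n; lia.
have M0 : 0 < (N - n - d)%:R :> R by rewrite ltr0n; lia.
rewrite ler_pdivlMr //.
apply: (@le_trans _ _ (((N - n - d)%:R / (N - n)%:R) ^+ n * 'C(N, n)%:R)); last first.
  rewrite expr_div_n mulrAC ler_pdivrMr ?exprn_gt0 //.
  by rewrite -!natrX -!natrM ler_nat subnAC bin_lower //; lia.
rewrite ler_pM2r // -mulrN expRM_natl lerXn2r ?nnegrE ?expR_ge0 ?divr_ge0 ?(ltW N0) ?(ltW M0) //.
(* After inversion the base is [1 + d / (N - n - d)], so [1 + x <= exp x] gives a lower bound. *)
rewrite expRN -[leRHS]invf_div lef_pV2 ?posrE ?expR_gt0 ?divr_gt0 //.
apply: le_trans (expR_ge1Dx _).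
rewrite [X in X / _ <= _](_ : _ = (N - n - d)%:R + d%:R); last by rewrite -natrD; congr _%:R; lia.
by rewrite mulrDl divff ?gt_eqF.
Qed.

(** * Bounds on the expected proportion *)

Lemma average_le (R : realType) n (f : board n -> R) c : (0 < n)%N ->
  (forall x, f x <= c) -> (\sum_x f x) / (n ^ 3)%N%:R <= c.
Proof.
move=> n0 fc; rewrite ler_pdivrMr ?ltr0n ?expn_gt0 ?n0 //.
rewrite -card_board mulr_natr -sumr_const; exact: ler_sum.
Qed.

Lemma average_ge (R : realType) n (f : board n -> R) c : (0 < n)%N ->
  (forall x, c <= f x) -> c <= (\sum_x f x) / (n ^ 3)%N%:R.
Proof.
move=> n0 fc; rewrite ler_pdivlMr ?ltr0n ?expn_gt0 ?n0 //.
rewrite -card_board mulr_natr -sumr_const; exact: ler_sum.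
Qed.

Lemma mu_le (R : realType) n : (0 < n)%N -> mu R n <= expR (18 / n%:R - 3 / 2).
Proof.
move=> n0; rewrite muE; apply: average_le => // x.
have [dlo _] := card_attackers_bounds x.
have N0 : (0 < n ^ 3)%N by rewrite expn_gt0 n0.
apply: le_trans (bin_ratio_le _ _ _ _) _ => //; first by rewrite -{1}(expn1 n) leq_pexp2l.
  by rewrite -card_board max_card.
rewrite ler_expR; move: dlo; move: #|_| => d; rewrite -(ler_nat R) natrD (natrM _ 3) natrX !natrM => dlo.
have n0' : 0 < n%:R :> R by rewrite ltr0n.
have -> : n%:R * (d%:R / n%:R ^+ 3) = d%:R / n%:R ^+ 2 :> R by field; rewrite gt_eqF.
suff : 3 / 2 - 18 / n%:R <= d%:R / n%:R ^+ 2 :> R by lra.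
rewrite ler_pdivlMr ?exprn_gt0 //.
have -> : (3 / 2 - 18 / n%:R) * n%:R ^+ 2 = 3 / 2 * n%:R ^+ 2 - 18 * n%:R :> R.
  by field; rewrite gt_eqF.
lra.
Qed.

Lemma mu_ge (R : realType) n : (10 <= n)%N -> expR (- 3 - 100 / n%:R) <= mu R n.
Proof.
move=> n10; rewrite muE; apply: average_ge => [|x]; first by lia.
have [_ dup] := card_attackers_bounds x; move: dup; move: #|_| => d dup.
have big : (3 * n ^ 2 + 1 + n < n ^ 3)%N by rewrite !expnS expn0; nia.
apply: le_trans (bin_ratio_ge _ _); last by lia.
have n0 : 0 < n%:R :> R by rewrite ltr0n; lia.
have M0 : 0 < (n ^ 3 - n - d)%:R :> R by rewrite ltr0n; lia.
rewrite ler_expR -opprD lerN2 mulrA ler_pdivrMr //.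
rewrite -(ler_pM2r n0).
have -> : (3 + 100 / n%:R) * (n ^ 3 - n - d)%:R * n%:R =
  ((3 * n + 100) * (n ^ 3 - n - d))%:R :> R.
  by rewrite natrM natrD natrM; field; rewrite gt_eqF.
rewrite -!natrM ler_nat.
(* The worst case is [d = 3 n^2 + 1]; the generous constant 100 absorbs the lower-order terms. *)
apply: (@leq_trans ((3 * n + 100) * (n ^ 3 - n - (3 * n ^ 2 + 1)))%N); last first.
  by rewrite leq_mul2l; lia.
apply: (@leq_trans (n * (3 * n ^ 2 + 1) * n)%N); first by nia.
move: big; rewrite !expnS expn0; nia.
Qed.

(** * Passage to the limit *)

Lemma limn_einf_ge_of_cvg (R : realType) (u v : nat -> R) (l : R) N :
  (forall n, (N <= n)%N -> v n <= u n) -> (v n @[n --> \oo] --> l)%classic ->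
  (l%:E <= limn_einf (fun n => (u n)%:E))%E.
Proof.
move=> vu vl.
have vlE : ((v n)%:E @[n --> \oo] --> l%:E)%classic by apply: cvg_EFin => //; exact: nearW.
rewrite -(cvg_limn_einf_sup vlE).1 !limn_einf_lim.
apply: lee_lim; [exact: is_cvg_einfs..|].
exists N => // n /= Nn.
apply: le_ereal_inf_tmp => _ [m /= nm <-]; apply: ereal_inf_le.
exists (v m)%:E; last by rewrite lee_fin vu //=; exact: leq_trans nm.
by exists m.
Qed.

Lemma limn_esup_le_of_cvg (R : realType) (u v : nat -> R) (l : R) N :
  (forall n, (N <= n)%N -> u n <= v n) -> (v n @[n --> \oo] --> l)%classic ->
  (limn_esup (fun n => (u n)%:E) <= l%:E)%E.
Proof.
move=> uv vl; rewrite -[leLHS]oppeK -limn_einfN leeNl.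
apply: (@limn_einf_ge_of_cvg _ (fun n => - u n) (fun n => - v n) _ N) => [n /uv|].
  by rewrite lerN2.
exact: cvgN.
Qed.

Lemma cvg_expR_harmonic (R : realType) (a b : R) :
  (expR (a + b / n.+1%:R) @[n --> \oo] --> expR a)%classic.
Proof.
apply: continuous_cvg; first exact: continuous_expR.
rewrite -[X in (_ --> X)%classic]addr0 -[X in _ + X](mulr0 b).
apply: cvgD; first exact: cvg_cst.
apply: cvgM; first exact: cvg_cst.
exact: cvg_harmonic.
Qed.

(* The sequences are indexed by n.+1 since the board side is positive. *)
Theorem mainTheorem8 (R : realType) :
  [/\ ((1 / expR (3 : R))%:E <= limn_einf (fun n : nat => (mu R n.+1)%:E))%E,
      (limn_einf (fun n : nat => (mu R n.+1)%:E)
         <= limn_esup (fun n : nat => (mu R n.+1)%:E))%E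
    & (limn_esup (fun n : nat => (mu R n.+1)%:E)
         <= (1 / expR (3 / 2 : R))%:E)%E].
Proof.
rewrite !div1r -!expRN; split; last 1 first.
- apply: (@limn_esup_le_of_cvg _ _ _ _ 0 _ (@cvg_expR_harmonic R _ 18)) => n _.
  by rewrite addrC mu_le.
(* Rank 9 makes the side [n.+1] at least 10, as [mu_ge] requires. *)
- apply: (@limn_einf_ge_of_cvg _ _ _ _ 9 _ (@cvg_expR_harmonic R _ (- 100))) => n n9.
  by rewrite mulNr mu_ge.
- exact: limn_einf_sup.
Qed.
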